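(* Let $k\ge2$, let $\mathcal{P}_1,\dots,\mathcal{P}_k\subseteq\mathbb{R}^n$ be nonempty convex sets and let $\mathcal{P}:=\prod_{i=1}^k\mathcal{P}_i\subseteq\mathbb{R}^{nk}$, writing $x=(x^1,\dots,x^k)$ with $x^i\in\mathbb{R}^n$. Assume that the function $$f(x) := \frac{1}{2k}\sum_{i=1}^{k-1}\sum_{j=i+1}^{k}\|x^i-x^j\|^2$$ attains its minimum over $\mathcal{P}$. Then $f$ is convex, $1$-smooth, and $1$-Polyak-Łojasiewicz over $\mathcal{P}$.
   Context: $\|\cdot\|$ is the Euclidean norm. A function $f$ differentiable on an open set containing a convex set $\mathcal{X}$ is convex in $\mathcal{X}$ if $0\le f(x)-f(y)-\langle\nabla f(y),x-y\rangle$ for all $x,y\in\mathcal{X}$, and $L$-smooth in $\mathcal{X}$ if $f(x)-f(y)-\langle\nabla f(y),x-y\rangle\le\frac{L}{2}\|x-y\|^2$ for all $x,y\in\mathcal{X}$. Assuming the solution set $\arg\min_{x\in\mathcal{X}}f(x)$ is nonempty, with minimum value $f^*:=\min_{x\in\mathcal{X}}f(x)$, $f$ is $\mu$-Polyak-Łojasiewicz in $\mathcal{X}$ if $\frac12\|\nabla f(x)\|^2\ge\mu(f(x)-f^* )$ for all $x\in\mathcal{X}$. *)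

(* Defs.v *)
From HB Require Import structures.
From mathcomp Require Import all_boot all_order all_algebra.
From mathcomp Require Import all_classical all_reals all_analysis.
Set Implicit Arguments.
Unset Strict Implicit.
Unset Printing Implicit Defensive.
Import Order.TTheory GRing.Theory Num.Theory numFieldNormedType.Exports.
Local Open Scope classical_set_scope.
Local Open Scope ring_scope.

Definition dotp (R : realType) (m : nat) (u v : 'rV[R]_m) : R :=
  \sum_(i < m) u 0 i * v 0 i.

(* The norm [`|u|] that MathComp-Analysis puts on ['rV[R]_m] is the sup norm,
   so the Euclidean one is defined here.  Both induce the same topology, hence
   the same notions of open set and of differentiability. *)
Definition enorm (R : realType) (m : nat) (u : 'rV[R]_m) : R :=
  Num.sqrt (dotp u u).

Definition grad (R : realType) (m : nat) (f : 'rV[R]_m -> R) (x : 'rV[R]_m) :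
    'rV[R]_m :=
  \row_(i < m) 'D_(delta_mx 0 i) f x.

(* Standing assumption under which convexity, smoothness and the
   Polyak-Lojasiewicz property in [X] are defined. *)
Definition differentiable_around (R : realType) (m : nat)
    (X : set 'rV[R]_m) (f : 'rV[R]_m -> R) : Prop :=
  convex_set X /\
  exists U : set 'rV[R]_m,
    [/\ open U, X `<=` U & forall x, U x -> differentiable f x].

(* [f x - f y - <grad f y, x - y>] *)
Definition bregman (R : realType) (m : nat) (f : 'rV[R]_m -> R)
    (x y : 'rV[R]_m) : R :=
  f x - f y - dotp (grad f y) (x - y).

Definition convex_in (R : realType) (m : nat)
    (X : set 'rV[R]_m) (f : 'rV[R]_m -> R) : Prop :=
  differentiable_around X f /\
  forall x y, X x -> X y -> 0 <= bregman f x y.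

Definition smooth_in (R : realType) (m : nat) (L : R)
    (X : set 'rV[R]_m) (f : 'rV[R]_m -> R) : Prop :=
  differentiable_around X f /\
  forall x y, X x -> X y -> bregman f x y <= L / 2 * enorm (x - y) ^+ 2.

Definition argmin_in (R : realType) (m : nat)
    (X : set 'rV[R]_m) (f : 'rV[R]_m -> R) : set 'rV[R]_m :=
  [set x | X x /\ forall y, X y -> f x <= f y].

Definition is_min_value (R : realType) (m : nat)
    (X : set 'rV[R]_m) (f : 'rV[R]_m -> R) (v : R) : Prop :=
  exists2 x, argmin_in X f x & f x = v.

(* The minimum value is unique, so the quantifier over [fstar] just names it;
   its existence is the nonemptiness of [argmin_in X f]. *)
Definition polyak_lojasiewicz_in (R : realType) (m : nat) (mu : R)
    (X : set 'rV[R]_m) (f : 'rV[R]_m -> R) : Prop :=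
  differentiable_around X f /\
  exists2 fstar, is_min_value X f fstar &
    forall x, X x -> mu * (f x - fstar) <= 1 / 2 * enorm (grad f x) ^+ 2.

(* A point of R^(nk) is a row vector of length [k * n], listing its [k] blocks
   of length [n] one after the other ([vec_mx] is row-major). *)
Definition block (R : realType) (k n : nat) (x : 'rV[R]_(k * n)) (i : 'I_k) :
    'rV[R]_n :=
  row i (vec_mx x).

Definition prod_set (R : realType) (k n : nat) (P : 'I_k -> set 'rV[R]_n) :
    set 'rV[R]_(k * n) :=
  [set x | forall i, P i (block x i)].

Definition pairwise_energy (R : realType) (k n : nat) (x : 'rV[R]_(k * n)) : R :=
  1 / (2 * k%:R) *
  \sum_(i < k) \sum_(j < k | (i < j)%N) enorm (block x i - block x j) ^+ 2.

(* Main.v *)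
Require Import Defs.
From HB Require Import structures.
From mathcomp Require Import all_boot all_order all_algebra.
From mathcomp Require Import all_classical all_reals all_analysis.
From mathcomp Require Import ring lra.
Import Order.TTheory GRing.Theory Num.Theory numFieldNormedType.Exports.
Local Open Scope classical_set_scope.
Local Open Scope ring_scope.

(** Let Q be the map that subtracts from every block the mean of all blocks.
It is the orthogonal projection onto the configurations whose blocks sum to
zero, and the pairwise distances only see this part: since
  sum_(i < j) |x^i - x^j|^2 = k sum_i |x^i|^2 - |sum_i x^i|^2,
the energy is f x = |Q x|^2 / 2 ([pairwise_energyE]).

Everything then holds for half the squared norm of an arbitrary orthogonal
projection.  Such an f is a quadratic form with gradient Q x, so its Bregman
divergence at (x, y) is f (x - y) exactly ([half_sqr_proj_bregman]).  Convexity
is the inequality 0 <= f, and 1-smoothness says that a projection does not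
increase the norm ([half_sqr_proj_le]).  Finally |grad f x|^2 / 2 = f x, which
is at least f x - f* because the minimum value f* over the product is
nonnegative; this is the Polyak-Lojasiewicz inequality with constant 1. *)

(** * The Euclidean inner product *)

Section InnerProduct.
Context {R : realType} {m : nat}.
Implicit Types u v w : 'rV[R]_m.

Lemma dotpC u v : dotp u v = dotp v u.
Proof. by apply: eq_bigr => i _; rewrite mulrC. Qed.

Lemma dotpDl u v w : dotp (u + v) w = dotp u w + dotp v w.
Proof. by rewrite -big_split; apply: eq_bigr => i _; rewrite mxE mulrDl. Qed.

Lemma dotpZl a u w : dotp (a *: u) w = a * dotp u w.
Proof. by rewrite mulr_sumr; apply: eq_bigr => i _; rewrite mxE mulrA. Qed.

Lemma dotpDr u v w : dotp w (u + v) = dotp w u + dotp w v.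
Proof. by rewrite dotpC dotpDl !(dotpC _ w). Qed.

Lemma dotpZr a u w : dotp w (a *: u) = a * dotp w u.
Proof. by rewrite dotpC dotpZl dotpC. Qed.

Lemma dotpNl u w : dotp (- u) w = - dotp u w.
Proof. by rewrite -scaleN1r dotpZl mulN1r. Qed.

Lemma dotpNr u w : dotp w (- u) = - dotp w u.
Proof. by rewrite dotpC dotpNl dotpC. Qed.

Lemma dotp_ge0 u : 0 <= dotp u u.
Proof. by apply: sumr_ge0 => i _; rewrite -expr2 sqr_ge0. Qed.

Lemma sqr_enorm u : enorm u ^+ 2 = dotp u u.
Proof. by rewrite sqr_sqrtr// dotp_ge0. Qed.

Lemma dotp_delta u i : dotp u (delta_mx 0 i) = u 0 i.
Proof.
rewrite /dotp (bigD1 i)//= big1 ?addr0 ?mxE ?eqxx ?mulr1// => j ji.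
by rewrite mxE eqxx (negbTE ji) mulr0.
Qed.

End InnerProduct.

(** * Half the squared norm of an orthogonal projection *)

Section HalfSquaredProjection.
Context {R : realType} {m : nat} (Q : {linear 'rV[R]_m -> 'rV[R]_m}).
(* This single identity says that Q is an orthogonal projection: exchanging x
   and y gives self-adjointness, and then dotp (Q x) y = dotp (Q (Q x)) y gives
   idempotence. *)
Hypothesis Q_orthoproj : forall x y, dotp (Q x) y = dotp (Q x) (Q y).

Let f x : R := 2^-1 * dotp (Q x) (Q x).

(** In coordinates, f is a polynomial. *)
Lemma half_sqr_proj_differentiable x : differentiable f x.
Proof.
have -> : f = 2^-1 *: \sum_(i < m) (fun x => Q x 0 i) * (fun x => Q x 0 i).
  by apply/funext => y; rewrite /f /dotp /GRing.scale/= fct_sumE.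
apply: differentiableZ; apply: differentiable_sum => i.
have dQ : differentiable (fun x => Q x 0 i : R) x.
  have -> : (fun x => Q x 0 i) =
      \sum_(j < m) (lin1_mx Q j i *: (fun x : 'rV[R]_m => x 0 j : R)).
    apply/funext => y; rewrite fct_sumE -mul_rV_lin1 mxE.
    by apply: eq_bigr => j _; rewrite mulrC.
  apply: differentiable_sum => j; apply: differentiableZ.
  exact: differentiable_coord.
exact: differentiableM.
Qed.

(** The exact second-order Taylor expansion of the quadratic form f; both its
gradient and its Bregman divergence are read off from it. *)
Lemma half_sqr_proj_expand x v h :
  f (h *: v + x) = f x + h * dotp (Q x) v + h ^+ 2 * f v.
Proof.
rewrite /f (Q_orthoproj x v) linearP !(dotpDl, dotpDr, dotpZl, dotpZr).
rewrite (dotpC (Q v) (Q x)); by field.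
Qed.

Lemma half_sqr_proj_derive x v : 'D_v f x = dotp (Q x) v.
Proof.
apply: cvg_lim => //.
(* By the expansion, the right-hand side is the difference quotient itself
   away from h = 0. *)
have : (fun h : R => dotp (Q x) v + h * f v) @ 0^' --> dotp (Q x) v.
  rewrite -[X in _ --> X]addr0 -[X in _ --> _ + X](mul0r (f v)).
  apply: cvgD; first exact: cvg_cst.
  apply: cvgMl; apply: cvg_within_filter; exact: cvg_id.
apply: cvg_trans; apply: near_eq_cvg.
apply: filterS (nbhs_dnbhs_neq (0 : R)) => h h0 /=.
rewrite /GRing.scale/= half_sqr_proj_expand; by field.
Qed.

Lemma half_sqr_proj_grad x : grad f x = Q x.
Proof.
by apply/rowP => i; rewrite mxE half_sqr_proj_derive dotp_delta.
Qed.

(** The first-order Taylor remainder of a quadratic form is the form itself,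
evaluated at the increment. *)
Lemma half_sqr_proj_bregman x y : bregman f x y = f (x - y).
Proof.
rewrite /bregman half_sqr_proj_grad -{1}(subrK y x) -[X in f (X + y)]scale1r.
rewrite half_sqr_proj_expand; by ring.
Qed.

(** A projection does not increase the norm: the squared norm of x - Q x is the
difference of the squared norms of x and Q x. *)
Lemma half_sqr_proj_le x : f x <= 1 / 2 * enorm x ^+ 2.
Proof.
rewrite div1r sqr_enorm ler_wpM2l// ?invr_ge0//.
have := dotp_ge0 (x - Q x).
rewrite !(dotpDl, dotpDr, dotpNl, dotpNr) (dotpC x (Q x)) (Q_orthoproj x x); lra.
Qed.

End HalfSquaredProjection.

(** * The pairwise energy as a squared projection *)

Section Energy.
Context {R : realType} {k n : nat}.
Hypothesis k_gt0 : (0 < k)%N.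

(** Turns inner products of concatenated blocks into traces, so that the block
structure is handled by matrix algebra on k x n matrices. *)
Lemma dotp_mxvec (A B : 'M[R]_(k, n)) :
  dotp (mxvec A) (mxvec B) = \tr (A *m B^T).
Proof.
transitivity (\sum_i \sum_j A i j * B i j).
  rewrite /dotp (reindex _ (curry_mxvec_bij _ _)) pair_bigA /=.
  by apply: eq_bigr => -[i j] _ /=; rewrite !mxvecE.
apply: eq_bigr => i _; rewrite mxE.
by apply: eq_bigr => j _; rewrite mxE.
Qed.

(** Left multiplication by this matrix subtracts the mean of the rows from each
row; the rows will be the blocks. *)
Definition centering_mx : 'M[R]_k := 1%:M - const_mx k%:R^-1.

Definition center : 'rV[R]_(k * n) -> 'rV[R]_(k * n) :=
  mxvec \o mulmx centering_mx \o vec_mx.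

HB.instance Definition _ := GRing.Linear.on center.

Lemma tr_centering_mx : centering_mx^T = centering_mx.
Proof. by rewrite /centering_mx linearB/= trmx1 trmx_const. Qed.

Lemma centering_mx_idem : centering_mx *m centering_mx = centering_mx.
Proof.
have kN0 : k%:R != 0 :> R by rewrite pnatr_eq0 -lt0n.
rewrite /centering_mx mulmxBr mulmx1 mulmxBl mul1mx.
set J := const_mx _; suff -> : J *m J = J by rewrite subrr subr0.
apply/matrixP => i j; rewrite !mxE.
under eq_bigr do rewrite !mxE.
by rewrite sumr_const card_ord -[LHS]mulr_natl mulVKf.
Qed.

(** The centering matrix C is symmetric and idempotent, hence
tr (C X (C Y)^T) = tr (C C X Y^T) = tr (C X Y^T). *)
Lemma center_orthoproj x y : dotp (center x) y = dotp (center x) (center y).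
Proof.
rewrite -{1}(vec_mxK y) !dotp_mxvec trmx_mul tr_centering_mx mulmxA.
by rewrite [in RHS]mxtrace_mulC !mulmxA centering_mx_idem.
Qed.

Lemma sum_ltn_sym (a : 'I_k -> 'I_k -> R) :
  (forall i j, a i j = a j i) -> (forall i, a i i = 0) ->
  2 * \sum_(i < k) \sum_(j < k | (i < j)%N) a i j = \sum_i \sum_j a i j.
Proof.
move=> aC a0; rewrite mulr_natl mulr2n.
rewrite [X in _ + X](exchange_big_dep xpredT)//= -big_split/=.
apply: eq_bigr => i _; rewrite [RHS](bigID (fun j : 'I_k => (i < j)%N))/=.
congr (_ + _); rewrite [RHS](bigD1 i) ?ltnn//= a0 add0r.
apply: eq_big => [j|j _]; last exact: aC.
by rewrite -leqNgt ltn_neqAle andbC.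
Qed.

(** Both sides are linear in the Gram matrix G of the blocks.  Its entries give
|x^i - x^j|^2 = G i i + G j j - 2 G i j, so each side equals
(tr G - k^-1 sum_(i, j) G i j) / 2. *)
Lemma pairwise_energyE (x : 'rV[R]_(k * n)) :
  pairwise_energy x = 2^-1 * dotp (center x) (center x).
Proof.
have kN0 : k%:R != 0 :> R by rewrite pnatr_eq0 -lt0n.
pose G := vec_mx x *m (vec_mx x)^T.
have dotG i j : dotp (block x i) (block x j) = G i j.
  by rewrite mxE; apply: eq_bigr => c _; rewrite !mxE.
have sqG i j : enorm (block x i - block x j) ^+ 2 = G i i + G j j - 2 * G i j.
  rewrite sqr_enorm !(dotpDl, dotpDr, dotpNl, dotpNr) (dotpC (block x j)).
  by rewrite !dotG; ring.
have GC i j : G i j = G j i by rewrite -!dotG dotpC.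
have trG : 2 * \sum_(i < k) \sum_(j < k | (i < j)%N)
      enorm (block x i - block x j) ^+ 2
    = 2 * k%:R * \tr G - 2 * \sum_i \sum_j G i j.
  rewrite sum_ltn_sym => [|i j|i]; last 2 first.
    by rewrite !sqG (GC j i); ring.
    by rewrite sqG; ring.
  under eq_bigr => i _.
    under eq_bigr do rewrite sqG.
    rewrite sumrB big_split/= sumr_const card_ord -mulr_sumr; over.
  rewrite sumrB big_split/= sumr_const card_ord -mulr_sumr sumrMnl.
  by rewrite -(mulr_natl (\sum_i G i i) k) /mxtrace; ring.
have centerG : dotp (center x) x = \tr G - k%:R^-1 * \sum_i \sum_j G i j.
  rewrite -{2}(vec_mxK x) dotp_mxvec -mulmxA -/G mulmxBl mul1mx linearB/=.
  congr (_ - _); rewrite exchange_big mulr_sumr/=.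
  apply: eq_bigr => i _; rewrite mxE mulr_sumr.
  by apply: eq_bigr => j _; rewrite mxE.
rewrite -center_orthoproj centerG.
rewrite /pairwise_energy; set S := \sum_(i < k) \sum_(j < k | _) _ in trG *.
have -> : S = k%:R * \tr G - \sum_i \sum_j G i j.
  apply: (mulfI (_ : 2 != 0)); first by rewrite pnatr_eq0.
  by rewrite trG; ring.
by field.
Qed.

End Energy.

(** * The product set and the conclusion *)

Lemma convex_prod_set (R : realType) (n k : nat) (P : 'I_k -> set 'rV[R]_n) :
  (forall i, convex_set (P i)) -> convex_set (prod_set P).
Proof.
move=> cP x y t; rewrite !inE => Px Py i.
have := cP i (block x i) (block y i) t.
rewrite !inE => /(_ (Px i) (Py i)); congr (P i _).
by rewrite /block; apply/rowP => j; rewrite !mxE.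
Qed.

Theorem proposition5p1 (R : realType) (n k : nat) (hk : (2 <= k)%N)
    (P : 'I_k -> set 'rV[R]_n)
    (P_nonempty : forall i, P i !=set0)
    (P_convex : forall i, convex_set (P i))
    (f_attains_min : argmin_in (prod_set P) (@pairwise_energy R k n) !=set0) :
  [/\ convex_in (prod_set P) (@pairwise_energy R k n),
      smooth_in 1 (prod_set P) (@pairwise_energy R k n)
    & polyak_lojasiewicz_in 1 (prod_set P) (@pairwise_energy R k n)].
Proof.
have k_gt0 : (0 < k)%N by exact: ltnW.
have cproj := @center_orthoproj R k n k_gt0.
have fE : @pairwise_energy R k n = fun x => 2^-1 * dotp (center x) (center x).
  by apply/funext => x; exact: pairwise_energyE.
have f_ge0 (x : 'rV[R]_(k * n)) : 0 <= 2^-1 * dotp (center x) (center x).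
  by rewrite mulr_ge0 ?invr_ge0// dotp_ge0.
have [xs xs_min] := f_attains_min; rewrite fE in xs_min *.
have around : differentiable_around (prod_set P)
    (fun x => 2^-1 * dotp (center x) (center x)).
  split; first exact: convex_prod_set.
  exists setT; split => // [|x _]; first exact: openT.
  exact: half_sqr_proj_differentiable.
split; split => //.
- by move=> x y _ _; rewrite half_sqr_proj_bregman//; exact: f_ge0.
- by move=> x y _ _; rewrite half_sqr_proj_bregman//; exact: half_sqr_proj_le.
- eexists; first by exists xs.
  move=> x _; rewrite half_sqr_proj_grad// sqr_enorm mul1r div1r.
  by rewrite gerBl.
Qed.
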